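(* Let $p$ be a prime, let $S$ be a finite commutative semigroup such that $\exp(S)$ is a power of $p$, and let $R$ be a commutative unitary ring of characteristic $p$. Then: (i) If $T=s_1\cdots s_\ell$ is a sequence over $S$ with $\ell\ge\Lambda(S)$, then $\prod_{i=1}^\ell(X^{s_i}-X^{e(s_i)})=0$ in $R[X;S]$, and moreover ${\rm St}(e)\cap\Sigma(T)\ne\emptyset$, where $e=\sum_{i=1}^\ell e(s_i)$; (ii) $d(S,R)\le\Lambda(S)-1$.
   Context: Semigroups are commutative, written additively; $\langle x\rangle=\{mx:m\ge1\}$; $e(x)$ is the unique idempotent in $\langle x\rangle$ and $\rho(x)$ is the least positive integer $m$ with $mx=e(x)$. The period of $x$ is the least $n>0$ with $(k+n)x=kx$, $k$ being the index of $x$; $\exp(S)$ is the lcm of all periods. $\Lambda(S)=\min_A\{1+\sum_{a\in A}(\rho(a)-1)\}$, where $A$ ranges over all generating sets of $S$. $R[X;S]$ is the semigroup ring with basis $\{X^s\}$ and $X^sX^t=X^{s+t}$. For $e\in S$, ${\rm St}(e)=\{c\in S:c+e=e\}$. For a sequence $T$ over $S$, $\Sigma(T)$ is the set of sums of nonempty subsequences of $T$. $d(S,R)$ is the supremum of all $\ell$ such that some sequence $s_1\cdots s_\ell$ over $S$ satisfies $\prod_i(X^{s_i}-a_iX^{e(s_i)})\ne0$ for all $a_1,\dots,a_\ell\in R\setminus\{0\}$. *)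

(* Defs.v *)
From HB Require Import structures.
From mathcomp Require Import all_boot all_order all_algebra.
From mathcomp Require Import boolp classical_sets constructive_ereal.

Set Implicit Arguments.
Unset Strict Implicit.
Unset Printing Implicit Defensive.

Import Order.TTheory GRing.Theory Num.Theory.
Local Open Scope ring_scope.

Section Semigroup.
(* A finite commutative semigroup is a finite type [S] together with an
   associative and commutative operation [add]. *)
Variables (S : finType) (add : SemiGroup.com_law S).
Implicit Types (x y c e : S) (T : seq S) (A B : {set S}).

Local Notation "x +_s y" := (add x y) (at level 50, left associativity).

Lemma sgaddA : associative add. Proof. exact: SemiGroup.opA. Qed.
Lemma sgaddC : commutative add. Proof. exact: SemiGroup.opC. Qed.

(* A semigroup need not have a zero: [nmul m x] is meaningful only for
   [0 < m], and [nmul 0 x] is the junk value [x]. *)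
Definition nmul (m : nat) x : S := iterop m add x x.

Lemma nmulS m x : (0 < m)%N -> nmul m.+1 x = x +_s nmul m x.
Proof. by case: m. Qed.

Lemma nmulD m n x : (0 < m)%N -> (0 < n)%N ->
  nmul (m + n) x = nmul m x +_s nmul n x.
Proof.
move=> + n0; elim: m => // -[_ _|m IH _]; first by rewrite add1n nmulS.
by rewrite addSn nmulS ?addn_gt0 // IH // sgaddA -nmulS.
Qed.

Lemma nmulM m n x : (0 < m)%N -> (0 < n)%N ->
  nmul (m * n) x = nmul m (nmul n x).
Proof.
move=> + n0; elim: m => // -[_ _|m IH _]; first by rewrite mul1n.
by rewrite mulSn nmulD ?muln_gt0 // IH // -nmulS.
Qed.

Lemma index_ex x : exists k,
  (0 < k)%N && `[< exists2 n, (0 < n)%N & nmul (k + n) x = nmul k x >].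
Proof.
have : ~~ injectiveb (fun i : 'I_#|S|.+1 => nmul i.+1 x).
  by apply/negP => /injectiveP /leq_card; rewrite card_ord ltnn.
case/injectivePn => i [j ne_ij eq_ij].
wlog lt_ij : i j ne_ij eq_ij / (i < j)%N => [hw|].
  have : (i != j :> nat) by [].
  by rewrite neq_ltn => /orP[/hw|/hw]; apply; rewrite // eq_sym.
exists i.+1; apply/asboolP; exists (j - i)%N; first by rewrite subn_gt0.
by rewrite addSn subnKC 1?ltnW.
Qed.

Definition sgindex x : nat := ex_minn (index_ex x).

Lemma period_ex x : exists n,
  (0 < n)%N && (nmul (sgindex x + n) x == nmul (sgindex x) x).
Proof.
rewrite /sgindex; case: ex_minnP => k /andP[_ /asboolP[n n0 nE]] _.
by exists n; rewrite n0 nE eqxx.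
Qed.

Definition period x : nat := ex_minn (period_ex x).

Definition sgexp : nat := \big[lcmn/1%N]_(x : S) period x.

Definition cyc x : {set S} :=
  [set y | `[< exists2 m, (0 < m)%N & y = nmul m x >]]%SET.

Definition idempotent_elt y : bool := y +_s y == y.

Lemma nmul_idem m y : (0 < m)%N -> idempotent_elt y -> nmul m y = y.
Proof.
by move=> + /eqP yy; elim: m => // -[//|m] IH _; rewrite nmulS // IH.
Qed.

Lemma cyc_idem_ex x : exists2 y, y \in cyc x & idempotent_elt y.
Proof.
have [k /andP[k0 /asboolP[n n0 nE]]] := index_ex x.
have cycle j : nmul (k + j * n) x = nmul k x.
  elim: j => [|j IH]; first by rewrite mul0n addn0.
  rewrite mulSn addnA; case: j IH => [_|j IH]; first by rewrite mul0n addn0 nE.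
  have jn0 : (0 < j.+1 * n)%N by rewrite muln_gt0.
  have kn0 : (0 < k + n)%N by rewrite addn_gt0 k0.
  by rewrite (nmulD x kn0 jn0) nE -nmulD.
exists (nmul (k * n) x).
  by rewrite inE; apply/asboolP; exists (k * n)%N => //; rewrite muln_gt0 k0.
apply/eqP; rewrite -nmulD ?muln_gt0 ?k0 //.
have [nE1|n1] := eqVneq n 1%N.
  by have := cycle k; rewrite nE1 !muln1.
have lt_k : (k < k * n)%N by rewrite ltn_Pmulr // ltn_neqAle eq_sym n1.
have -> : (k * n + k * n = (k + k * n) + (k * n - k))%N.
  by rewrite addnAC (subnKC (ltnW lt_k)).
have d0 : (0 < k * n - k)%N by rewrite subn_gt0.
have e0 : (0 < k + k * n)%N by rewrite addn_gt0 k0.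
by rewrite (nmulD x e0 d0) cycle -nmulD // (subnKC (ltnW lt_k)).
Qed.

Lemma cyc_idem_uniq x y z : y \in cyc x -> z \in cyc x ->
  idempotent_elt y -> idempotent_elt z -> y = z.
Proof.
rewrite !inE => -[m m0 ->] [n n0 ->] im jn.
by rewrite -(nmul_idem n0 im) -(nmul_idem m0 jn) -!nmulM // mulnC.
Qed.

(* The default value [x] is never reached, see [idemP]. *)
Definition idem x : S := odflt x [pick y in cyc x | idempotent_elt y].

Lemma idemP x : idem x \in cyc x /\ idempotent_elt (idem x).
Proof.
rewrite /idem; case: pickP => [y /andP[] //|].
by have [y yx iy] := cyc_idem_ex x => /(_ y); rewrite yx iy.
Qed.

Lemma rho_ex x : exists m, (0 < m)%N && (nmul m x == idem x).
Proof.
have [] := idemP x; rewrite inE => /asboolP[m m0 mE] _.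
by exists m; rewrite m0 mE eqxx.
Qed.

Definition rho x : nat := ex_minn (rho_ex x).

Definition subsemigroup B : bool :=
  [forall x in B, forall y in B, x +_s y \in B].

Definition generates A : bool :=
  [forall B : {set S}, (A \subset B) && subsemigroup B ==> (B == [set: S]%SET)].

Lemma generates_setT : generates [set: S]%SET.
Proof. by apply/forallP => B; apply/implyP => /andP[]; rewrite finset.subTset. Qed.

Definition Lambda_of A : nat := (1 + \sum_(a in A) (rho a - 1))%N.

Definition Lambda : nat :=
  Lambda_of [arg min_(A < [set: S]%SET | generates A) Lambda_of A].

(* The sum of a sequence. The empty sum is [None], since [S] need not have a
   zero; the sum of a nonempty sequence is always of the form [Some s]. *)
Definition sgsum T : option S := \big[oAC sgaddA sgaddC/None]_(x <- T) Some x.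

Lemma sgsum_cons x T : sgsum (x :: T) = Some (foldl add x T).
Proof.
elim: T x => [|y T IH] x; first by rewrite /sgsum big_seq1.
rewrite /= -IH /sgsum !big_cons.
case: (\big[_/_]_(_ <- T) _) => [z|] //; by rewrite !oACE sgaddA.
Qed.

Definition St e : {set S} := [set c | c +_s e == e]%SET.

(* [mask m T], for [m] a bit vector, ranges over the subsequences of [T]; the
   empty one does not contribute, its sum being [None]. *)
Definition Sigma T : {set S} :=
  [set c | [exists m : (size T).-tuple bool, sgsum (mask m T) == Some c]]%SET.

End Semigroup.

(* The semigroup ring R[X;S]. The alias of [{ffun S -> R}] keeps the convolution
   product apart from the pointwise product of functions. The ring has a unit
   only if [S] does, so that it is not an instance of MathComp's (unital) ring
   structures. *)
Definition sgring (R : comNzRingType) (S : finType) : Type := {ffun S -> R^o}.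

HB.instance Definition _ (R : comNzRingType) (S : finType) :=
  GRing.Lmodule.copy (sgring R S) {ffun S -> R^o}.

Section SemigroupRing.
Variables (R : comNzRingType) (S : finType) (add : SemiGroup.com_law S).
Implicit Types (f g h : sgring R S) (s t : S).

Definition Xpow s : sgring R S := [ffun t => (t == s)%:R].

Definition sgmul f g : sgring R S :=
  [ffun t => \sum_(uv : S * S | add uv.1 uv.2 == t) f uv.1 * g uv.2].

Lemma sgmulE f g (t : S) :
  sgmul f g t = \sum_u \sum_v f u * g v * (add u v == t)%:R.
Proof.
rewrite ffunE big_mkcond pair_big /=; apply: eq_bigr => uv _.
by case: eqP; rewrite ?mulr1 ?mulr0.
Qed.

Lemma sgmulC : commutative sgmul.
Proof.
move=> f g; apply/ffunP => t; rewrite !sgmulE exchange_big /=.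
by apply: eq_bigr => u _; apply: eq_bigr => v _; rewrite mulrC (mulrC (f v)) sgaddC mulrC.
Qed.

Lemma sgmulA_aux f g h (t : S) : sgmul f (sgmul g h) t =
  \sum_u \sum_v \sum_w f u * g v * h w * (add u (add v w) == t)%:R.
Proof.
rewrite sgmulE; apply: eq_bigr => u _.
transitivity (\sum_z \sum_v \sum_w
    f u * (g v * h w * (add v w == z)%:R) * (add u z == t)%:R).
  apply: eq_bigr => z _; rewrite sgmulE mulr_sumr mulr_suml.
  by apply: eq_bigr => v _; rewrite mulr_sumr mulr_suml.
rewrite exchange_big; apply: eq_bigr => v _; rewrite exchange_big /=.
apply: eq_bigr => w _; rewrite (bigD1 (add v w)) //= eqxx mulr1 big1.
  by rewrite addr0 !mulrA.
by move=> z; rewrite eq_sym => /negPf->; rewrite !mulr0 mul0r.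
Qed.

Lemma sgmulA : associative sgmul.
Proof.
move=> f g h; apply/ffunP => t; rewrite (sgmulC (sgmul f g)) !sgmulA_aux.
rewrite [RHS]exchange_big; apply: eq_bigr => u _ /=.
rewrite [RHS]exchange_big; apply: eq_bigr => v _ /=; apply: eq_bigr => w _.
rewrite [add w _]sgaddC -sgaddA; congr (_ * _).
by rewrite mulrC mulrA.
Qed.

Lemma sgmulDl : left_distributive sgmul +%R.
Proof.
move=> f g h; apply/ffunP => t; rewrite [RHS]ffunE !sgmulE -big_split.
apply: eq_bigr => u _ /=; rewrite -big_split; apply: eq_bigr => v _ /=.
by rewrite ffunE !mulrDl.
Qed.

Lemma sgmulZl a f g : sgmul (a *: f) g = a *: sgmul f g.
Proof.
apply/ffunP => t; rewrite [RHS]ffunE !sgmulE scaler_sumr.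
apply: eq_bigr => u _; rewrite scaler_sumr; apply: eq_bigr => v _.
by rewrite ffunE -[LHS]mulrA -[LHS]mulrA -[f u * g v * _]mulrA.
Qed.

Lemma sgmulX s t : sgmul (Xpow s) (Xpow t) = Xpow (add s t).
Proof.
apply/ffunP => r; rewrite sgmulE (bigD1 s) //= (bigD1 t) //= !ffunE !eqxx.
rewrite !mul1r eq_sym big1 ?addr0 => [|v /negPf vt]; last first.
  by rewrite !ffunE vt mulr0 mul0r.
rewrite big1 ?addr0 // => u /negPf us; rewrite big1 // => v _.
by rewrite !ffunE us !mul0r.
Qed.

(* As for [sgsum], the empty product is [None], which stands for a formal unit
   (in particular it differs from [Some 0]); the product of a nonempty sequence
   is always of the form [Some f]. *)
Definition sgprod (fs : seq (sgring R S)) : option (sgring R S) :=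
  \big[oAC sgmulA sgmulC/None]_(f <- fs) Some f.

Lemma sgprod_cons f fs : sgprod (f :: fs) = Some (foldl sgmul f fs).
Proof.
elim: fs f => [|g fs IH] f; first by rewrite /sgprod big_seq1.
rewrite /= -IH /sgprod !big_cons.
case: (\big[_/_]_(_ <- fs) _) => [h|] //; by rewrite !oACE sgmulA.
Qed.

Definition dset : set nat :=
  [set l | exists s : l.-tuple S, forall a : l.-tuple R,
     (forall i, tnth a i != 0) ->
     sgprod [seq Xpow sa.1 - sa.2 *: Xpow (idem add sa.1) | sa <- zip s a]
       <> Some 0]%classic.

(* A supremum of natural numbers, taken in the extended integers so that it is
   [+oo] when unbounded; it always exists, see [natsupP]. *)
Definition natsup (A : set nat) : \bar int :=
  supremum -oo%E [set (l%:Z)%:E | l in A]%classic.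

Lemma natsupP (A : set nat) :
  supremums [set (l%:Z)%:E | l in A]%classic (natsup A).
Proof.
set B := (X in supremums X _).
suff [z Bz] : exists z, supremums B z.
  rewrite /natsup -/B /supremum; case: eqP => [B0|_]; last first.
    by apply: xgetPex; exists z.
  by split=> [y|y _]; [rewrite B0 | exact: leNye].
have [[m mA]|nbA] := pselect (exists m, forall l, A l -> (l <= m)%N); last first.
  exists +oo%E; split=> [y _|y yB]; first exact: leey.
  rewrite leNgt; apply/negP => y_fin; apply: nbA.
  have yA l : A l -> ((l%:Z)%:E <= y)%E by move=> Al; apply: yB; exists l.
  case: y {yB} y_fin yA => [z|//|] _ zA.
    exists `|z|%N => l /zA; rewrite lee_fin -lez_nat => /le_trans; apply.
    by rewrite abszE ler_norm.
  by exists 0%N => l /zA.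
have [[l0 Al0]|nA] := pselect (exists l, A l); last first.
  exists -oo%E; split=> [w [l Al _]|y _]; last exact: leNye.
  by case: nA; exists l.
have exA : exists l, `[< A l >] by exists l0; apply/asboolP.
have ubA l : `[< A l >] -> (l <= m)%N by move/asboolP/mA.
case: (ex_maxnP exA ubA) => n /asboolP An maxn.
exists (n%:Z)%:E; split=> [_ [l Al <-]|y yB]; last by apply: yB; exists n.
by rewrite lee_fin lez_nat maxn //; apply/asboolP.
Qed.

Definition dconst : \bar int := natsup dset.

End SemigroupRing.

(* Main.v *)
Require Import Defs.
From HB Require Import structures.
From mathcomp Require Import all_boot all_order all_algebra.
From mathcomp Require Import boolp classical_sets constructive_ereal.
Set Implicit Arguments.
Unset Strict Implicit.
Unset Printing Implicit Defensive.

Import Order.TTheory GRing.Theory Num.Theory.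
Local Open Scope ring_scope.

(** The map [s |-> e(s)] is additive, so the telescoping identity
    [X^(s+t) - X^(e(s)+e(t)) = (X^s - X^e(s)) X^t + X^e(s) (X^t - X^e(t))] puts
    every [X^s - X^e(s)] in the ideal generated by the [X^a - X^e(a)], with [a]
    in a given generating set [A].  The Frobenius endomorphism, applied to a
    power of [p] equal to the period of [a], yields
    [(X^a - X^e(a))^rho(a) = 0], and the pigeonhole principle then kills every
    product of [Lambda(S)] such elements.  Multiplying a vanishing product by
    [X^e] turns each [X^e(s_i)] into [1]; the term [+- X^e] of the expansion has
    to be cancelled, so some nonempty subsum [c] satisfies [c + e = e].

    All computations take place in the unitization of [R[X;S]], which is the
    semigroup ring of the monoid [option S] obtained by adjoining a zero
    [None] to [S]. *)

(** * Multiples, idempotents and periods in [S], and [S] with a zero adjoined *)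

Section AdjoinZero.
Variables (S : finType) (add : SemiGroup.com_law S).
Implicit Types (x y : S) (m n k : nat).

Definition option_add : SemiGroup.com_law (option S) :=
  oAC (sgaddA add) (sgaddC add).

Lemma nmul_add m x y : (0 < m)%N ->
  nmul add m (add x y) = add (nmul add m x) (nmul add m y).
Proof.
elim: m => // -[//|m] IH _; rewrite !(nmulS _ (m := m.+1)) // IH //.
rewrite -!sgaddA; congr (add x _).
by rewrite !sgaddA (sgaddC add y).
Qed.

Lemma rho_gt0 x : (0 < rho add x)%N.
Proof. by rewrite /rho; case: ex_minnP => m /andP[]. Qed.

Lemma nmul_rho x : nmul add (rho add x) x = idem add x.
Proof. by rewrite /rho; case: ex_minnP => m /andP[_ /eqP]. Qed.

Lemma idem_idem x : add (idem add x) (idem add x) = idem add x.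
Proof. by have [_ /eqP] := idemP add x. Qed.

(** The multiple by [rho x * rho y] sends [x] to e(x) and [y] to e(y), so e(x) + e(y) lies in the
    cyclic semigroup of x + y, whose idempotent is unique. *)
Lemma idem_add x y : idem add (add x y) = add (idem add x) (idem add y).
Proof.
have [cxy ixy] := idemP add (add x y).
apply: (cyc_idem_uniq cxy) => //; last first.
  apply/eqP; rewrite -sgaddA [X in add _ X]sgaddC -sgaddA idem_idem.
  by rewrite sgaddA idem_idem.
have [rx ry] := (rho_gt0 x, rho_gt0 y).
rewrite inE; apply/asboolP; exists (rho add x * rho add y)%N.
  by rewrite muln_gt0 rx.
rewrite nmul_add ?muln_gt0 ?rx // {1}mulnC !nmulM // !nmul_rho.
by rewrite !nmul_idem //; apply/eqP; exact: idem_idem.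
Qed.

Lemma sgindex_gt0 x : (0 < sgindex add x)%N.
Proof. by rewrite /sgindex; case: ex_minnP => k /andP[]. Qed.

Lemma period_gt0 x : (0 < period add x)%N.
Proof. by rewrite /period; case: ex_minnP => n /andP[]. Qed.

Lemma nmul_period n x : (sgindex add x <= n)%N ->
  nmul add (n + period add x) x = nmul add n x.
Proof.
move=> le_n; have per : nmul add (sgindex add x + period add x) x =
    nmul add (sgindex add x) x.
  by rewrite /period; case: ex_minnP => m /andP[_ /eqP].
have [<-//|ne_n] := eqVneq (sgindex add x) n.
have n0 : (0 < n - sgindex add x)%N.
  by rewrite subn_gt0 ltn_neqAle ne_n.
rewrite -{1}(subnK le_n) -addnA nmulD ?addn_gt0 ?sgindex_gt0 // per.
by rewrite -nmulD ?sgindex_gt0 // subnK.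
Qed.

Lemma nmul_mul_period q n x : (sgindex add x <= n)%N ->
  nmul add (n + q * period add x) x = nmul add n x.
Proof.
move=> le_n; elim: q => [|q IH]; first by rewrite addn0.
by rewrite mulSn addnCA addnC nmul_period // (leq_trans le_n) ?leq_addr.
Qed.

(** Adding e(x) fixes [kx], so shifting [k] by [r], hence by [r %% n], does too; minimality of the
    period [n] then forces the remainder to vanish. *)
Lemma period_dvd_rho x : (period add x %| rho add x)%N.
Proof.
set k := sgindex add x; set n := period add x; set r := rho add x.
have [k0 r0] : (0 < k)%N /\ (0 < r)%N by rewrite sgindex_gt0 rho_gt0.
have n0 : (0 < n)%N by apply: period_gt0.
have idx : idempotent_elt add (idem add x) by have [] := idemP add x.
(* e(x) is also the multiple of [x] by [n * r], a multiple of the period. *)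
have k_idem : add (nmul add k x) (idem add x) = nmul add k x.
  rewrite -(nmul_idem n0 idx) -nmul_rho -(nmulM _ x n0 r0).
  by rewrite -nmulD ?muln_gt0 ?n0 // mulnC nmul_mul_period.
have kr : nmul add (k + r %% n) x = nmul add k x.
  rewrite -(@nmul_mul_period (r %/ n)) ?leq_addr // -addnA [(_ %% _ + _)%N]addnC.
  by rewrite -divn_eq nmulD // nmul_rho k_idem.
rewrite /dvdn eqn0Ngt; apply/negP => rn0; have := ltn_pmod r n0.
rewrite ltnNge => /negP; apply; rewrite {1}/n /period.
by case: ex_minnP => m _; apply; rewrite rn0 kr eqxx.
Qed.

Lemma period_dvd_sgexp x : (period add x %| sgexp add)%N.
Proof. by rewrite /sgexp (bigD1 x) //= dvdn_lcml. Qed.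

Lemma sgsum_cons_option x (T : seq S) :
  sgsum add (x :: T) = option_add (Some x) (sgsum add T).
Proof. by rewrite /sgsum big_cons. Qed.

End AdjoinZero.

(** The parameter [add] lets the type determine the product of its ring structure. *)
Definition unitized (R : comNzRingType) (S : finType)
  (add : SemiGroup.com_law S) : Type := sgring R (option S).

(** * The unitization as a commutative ring, and the embedding of R[X;S] *)

Section Unitization.
Variables (R : comNzRingType) (S : finType) (add : SemiGroup.com_law S).

HB.instance Definition _ := GRing.Lmodule.on (unitized R add).

Let one : unitized R add := Xpow R None.
Let mul : unitized R add -> unitized R add -> unitized R add :=
  sgmul (option_add add).

Let mulA : associative mul. Proof. exact: sgmulA. Qed.
Let mulC : commutative mul. Proof. exact: sgmulC. Qed.
Let mulDl : left_distributive mul +%R. Proof. exact: sgmulDl. Qed.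

Let mul1 : left_id one mul.
Proof.
have add0 v : option_add add None v = v by case: v.
move=> f; apply/ffunP => t; rewrite /mul sgmulE (bigD1 None) //= (bigD1 t) //=.
rewrite ffunE add0 !eqxx mul1r mulr1 big1 ?addr0 => [|v vt]; last first.
  by rewrite add0 (negPf vt) mulr0.
rewrite big1 ?addr0 // => u /negPf u0; rewrite big1 // => v _.
by rewrite ffunE u0 !mul0r.
Qed.

Let one_neq0 : one != 0.
Proof. by apply/eqP => /ffunP/(_ None)/eqP; rewrite !ffunE eqxx oner_eq0. Qed.

HB.instance Definition _ :=
  GRing.Zmodule_isComNzRing.Build (unitized R add) mulA mulC mul1 mulDl one_neq0.

Definition mon (u : option S) : unitized R add := Xpow R u.

Lemma monE u v : mon u v = (v == u)%:R.
Proof. by rewrite ffunE. Qed.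

Lemma mon_None : mon None = 1. Proof. by []. Qed.

Lemma monD u v : mon (option_add add u v) = mon u * mon v.
Proof. by rewrite -[RHS]/(sgmul _ _ _) sgmulX. Qed.

Lemma mon_add s t : mon (Some (add s t)) = mon (Some s) * mon (Some t).
Proof. exact: (monD (Some s) (Some t)). Qed.

Lemma mon_nmul m s : (0 < m)%N -> mon (Some (nmul add m s)) = mon (Some s) ^+ m.
Proof.
elim: m => // -[_ _|m IH _]; first by rewrite expr1.
by rewrite nmulS // mon_add IH // -exprS.
Qed.

Lemma mon_sgsum T : mon (sgsum add T) = \prod_(s <- T) mon (Some s).
Proof. by rewrite /sgsum (big_morph mon monD mon_None). Qed.

Lemma pchar_unitized p : p \in [pchar R] -> p \in [pchar unitized R add].
Proof.
move=> charR; rewrite inE /= (pcharf_prime charR); apply/eqP/ffunP => u.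
by rewrite ffunMnE (mulrn_pchar charR) ffunE.
Qed.

Lemma sum_option (F : option S -> R) : \sum_u F u = F None + \sum_s F (Some s).
Proof.
rewrite (bigD1 None) //= (reindex_omap Some id) => [|[]//].
by congr (_ + _); apply: eq_bigl => s; rewrite /= eqxx.
Qed.

Definition extend0 (f : sgring R S) : unitized R add :=
  [ffun u => if u is Some s then f s else 0].

Lemma extend0B : {morph extend0 : f g / f - g}.
Proof. by move=> f g; apply/ffunP => -[s|]; rewrite !ffunE ?subrr. Qed.

Lemma extend0_Xpow s : extend0 (Xpow R s) = mon (Some s).
Proof. by apply/ffunP => -[t|]; rewrite !ffunE. Qed.

Lemma extend0_eq0 f : extend0 f = 0 -> f = 0.
Proof. by move=> /ffunP f0; apply/ffunP => s; have := f0 (Some s); rewrite !ffunE. Qed.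

Lemma extend0M : {morph extend0 : f g / sgmul add f g >-> f * g}.
Proof.
move=> f g; apply/ffunP => u; rewrite -[_ * _]/(sgmul _ _ _) sgmulE sum_option.
rewrite big1 => [|v _]; last by rewrite ffunE !mul0r.
rewrite add0r ffunE; transitivity (\sum_s \sum_t
    f s * g t * (Some (add s t) == u)%:R); last first.
  apply: eq_bigr => s _; rewrite sum_option !ffunE mulr0 mul0r add0r.
  by apply: eq_bigr => t _; rewrite ffunE.
case: u => [r|]; first by rewrite sgmulE.
by rewrite big1 // => s _; rewrite big1 // => t _; rewrite mulr0.
Qed.

(** The formal unit [None] of [sgprod] becomes the actual unit. *)
Lemma extend0_sgprod fs :
  oapp extend0 1 (sgprod add fs) = \prod_(f <- fs) extend0 f.
Proof.
rewrite /sgprod (big_morph (oapp extend0 1) (id1 := 1) (op1 := *%R)) //.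
case=> [f|] [g|] /=; rewrite ?mul1r ?mulr1 //; exact: extend0M.
Qed.

End Unitization.

(** * Products in an ideal generated by nilpotent elements *)

Section NilpotentPigeonhole.
Variables (M : comNzRingType) (I : finType) (A : {set I}) (g : I -> M).
Variable r : I -> nat.
Hypothesis g_nil : forall a, a \in A -> g a ^+ r a = 0.

(** Induction on [s] with [k] general: expanding one factor moves some [g a] into the accumulated
    powers, so [size s] plus the total exponent is preserved. Once [s] is empty, some [k a] reaches
    [r a]. *)
Lemma prod_nilpotent_eq0 (T : Type) (F : T -> M) (s : seq T) (k : I -> nat) :
  (forall t, exists c : I -> M, F t = \sum_(a in A) c a * g a) ->
  (\sum_(a in A) (r a - 1) < size s + \sum_(a in A) k a)%N ->
  \prod_(a in A) g a ^+ k a * \prod_(t <- s) F t = 0.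
Proof.
move=> FE; elim: s k => [|t s IH] k /=.
  rewrite add0n => lt_k; have [a aA le_ra] : exists2 a, a \in A & (r a <= k a)%N.
    apply/exists_inP; apply: contraLR lt_k => /exists_inPn nle.
    rewrite -leqNgt leq_sum // => a /nle; rewrite -ltnNge.
    by case: (r a) => // n; rewrite subn1.
  rewrite (bigD1 a) //= -(subnK le_ra) exprD g_nil // mulr0 !mul0r //.
move=> lt_k; rewrite big_cons; have [c ->] := FE t.
rewrite mulr_suml mulr_sumr big1 // => a aA.
transitivity (c a * (\prod_(b in A) g b ^+ (k b + (b == a)) * \prod_(t <- s) F t)).
  have -> : \prod_(b in A) g b ^+ (k b + (b == a)) = g a * \prod_(b in A) g b ^+ k b.
    rewrite (bigD1 a) //= [in RHS](bigD1 a) //= eqxx addn1 exprS -mulrA.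
    by congr (_ * (_ * _)); apply: eq_bigr => b /andP[_ /negPf->]; rewrite addn0.
  by rewrite -!mulrA mulrCA; congr (_ * _); rewrite mulrCA.
rewrite IH ?mulr0 //; apply: (leq_trans lt_k).
rewrite big_split /= addSnnS !leq_add2l -addn1 leq_add2l.
by rewrite (bigD1 a) //= eqxx.
Qed.

End NilpotentPigeonhole.

(** * Vanishing products and stabilizing subsums *)

Section Vanishing.
Variables (p : nat) (R : comNzRingType) (S : finType) (add : SemiGroup.com_law S).
Hypothesis expS : exists r : nat, sgexp add = (p ^ r)%N.
Hypothesis charR : p \in [pchar R].

Local Notation X s := (mon R add (Some s)).
Local Notation e := (idem add).

Lemma mon_sub_idem_nilpotent a : (X a - X (e a)) ^+ rho add a = 0.
Proof.
set E := X (e a); set n := period add a.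
have n0 : (0 < n)%N by exact: period_gt0.
have r0 := rho_gt0 add a.
have EE : E * E = E by rewrite -mon_add idem_idem.
have EX m : E ^+ m.+1 = E.
  by elim: m => [|m IH]; rewrite ?expr1 // exprS IH EE.
have rE : X a ^+ rho add a = E by rewrite -mon_nmul // nmul_rho.
have nE : X a ^+ n * E = E.
  (* This exponent still gives [E] and is at least the index, so the period may be added to it. *)
  have E_high : E = X a ^+ (rho add a * (sgindex add a)).
    by rewrite exprM rE -(prednK (sgindex_gt0 add a)) EX.
  have rk0 : (0 < rho add a * sgindex add a)%N.
    by rewrite muln_gt0 r0 sgindex_gt0.
  rewrite {1}E_high mulrC -exprD -mon_nmul ?addn_gt0 ?rk0 //.
  by rewrite nmul_period ?mon_nmul -?E_high // leq_pmull.
have char_n : [pchar unitized R add].-nat n.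
  apply/andP; split=> //; apply/allP => q; rewrite mem_primes => /and3P[qq _ qn].
  have [r er] := expS; have : (q %| p ^ r)%N.
    by rewrite -er (dvdn_trans qn) // period_dvd_sgexp.
  rewrite Euclid_dvdX // => /andP[qp _].
  have pp := pcharf_prime charR.
  by rewrite (eqP (_ : q == p)) ?pchar_unitized // -dvdn_prime2.
have gn : (X a - E) ^+ n = X a ^+ n - E.
  by rewrite exprDn_pchar // exprNn_pchar // -(prednK n0) EX.
(* [E] absorbs [X a ^+ n] and itself, so all terms involving [E] collapse to a single [- E]. *)
have powB q : (X a ^+ n - E) ^+ q.+1 = (X a ^+ n) ^+ q.+1 - E.
  have qE j : (X a ^+ n) ^+ j * E = E.
    by elim: j => [|j IH]; rewrite ?mul1r // exprS -mulrA IH nE.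
  elim: q => [|q IH]; first by rewrite !expr1.
  rewrite exprSr IH mulrBr !mulrBl qE EE mulrC (mulrC E) nE subrr subr0.
  by rewrite -exprS.
(* The quotient of [rho a] by [n] is nonzero because [rho a] is positive, so [powB] applies. *)
have /dvdnP[q rq] := period_dvd_rho add a; case: q rq r0 => [-> //|q rq _].
by rewrite rq mulnC exprM gn powB -exprM mulnC -rq rE subrr.
Qed.

(** The elements [s] with such an expression form a subsemigroup containing [A], hence all of
    [S]. *)
Lemma mon_sub_idem_ideal (A : {set S}) (s : S) : generates add A ->
  exists c : S -> unitized R add,
    X s - X (e s) = \sum_(a in A) c a * (X a - X (e a)).
Proof.
move=> genA; pose B := [set s | `[< exists c : S -> unitized R add,
    X s - X (e s) = \sum_(a in A) c a * (X a - X (e a)) >]]%SET.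
suff /eqP BT : B == [set: S]%SET.
  by have : s \in B; [rewrite BT inE | rewrite inE => /asboolP].
apply: (implyP (forallP genA B)); apply/andP; split.
  apply/fintype.subsetP => a aA; rewrite inE; apply/asboolP.
  exists (fun b => (b == a)%:R); rewrite (bigD1 a) //= eqxx mul1r big1 ?addr0 //.
  by move=> b /andP[_ /negPf->]; rewrite mul0r.
apply/forall_inP => x; rewrite inE => /asboolP[c cE].
apply/forall_inP => y; rewrite inE => /asboolP[d dE].
rewrite inE; apply/asboolP; exists (fun a => X y * c a + X (e x) * d a).
rewrite (eq_bigr _ (fun a _ => mulrDl _ _ _)) big_split /=.
rewrite -(eq_bigr _ (fun a _ => mulrA (X y) _ _)) -mulr_sumr -cE.
rewrite -(eq_bigr _ (fun a _ => mulrA (X (e x)) _ _)) -mulr_sumr -dE.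
by rewrite idem_add !mon_add !mulrBr [X y * X x]mulrC [X y * _]mulrC addrA subrK.
Qed.

(** The pigeonhole is applied to a minimizing [A], from zero exponents; the [1 +] in [Lambda_of]
    gives its strict inequality. *)
Lemma prod_mon_sub_idem_eq0 (T : seq S) : (Lambda add <= size T)%N ->
  \prod_(s <- T) (X s - X (e s)) = 0.
Proof.
rewrite /Lambda; case: arg_minnP => [|A genA _ le_T]; first exact: generates_setT.
have := @prod_nilpotent_eq0 _ _ A (fun a => X a - X (e a)) (rho add).
move=> /(_ (fun a _ => mon_sub_idem_nilpotent a) _ (fun s => X s - X (e s)) T).
move=> /(_ (fun=> 0%N) (fun s => mon_sub_idem_ideal s genA)).
by rewrite (eq_bigr (fun=> 1)) // !big1_eq addn0 mul1r; apply.
Qed.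

(** The product expands into signed monomials at [u] plus a subsum; [u] collects the terms already
    chosen. *)
Lemma coef_mon_prod_eq0 (u : option S) (z : S) (T : seq S) :
  (forall m, size m = size T ->
     option_add add u (sgsum add (mask m T)) <> Some z) ->
  (mon R add u * \prod_(s <- T) (X s - 1)) (Some z) = 0.
Proof.
elim: T u => [|s T IH] u notz.
  rewrite big_nil mulr1 monE; case: eqP => // uz.
  by case: (notz [::] erefl); rewrite /sgsum big_nil -uz; case: (u).
rewrite big_cons mulrA mulrBr mulr1 mulrBl -monD.
have -> (f g : unitized R add) w : (f - g) w = f w - g w by rewrite !ffunE.
rewrite !IH ?subrr // => m sm.
  exact: (notz (false :: m) (congr1 succn sm)).
have := notz (true :: m) (congr1 succn sm).
by rewrite mask_cons /= sgsum_cons_option sgaddA.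
Qed.

(** Only the empty subsequence contributes, through the product of the [-1]; any other choice shifts
    [z] by a nonempty subsum, which does not fix [z]. *)
Lemma coef_mon_prod (z : S) (T : seq S) :
  (forall m c, size m = size T -> sgsum add (mask m T) = Some c ->
     add c z <> z) ->
  (X z * \prod_(s <- T) (X s - 1)) (Some z) = (-1) ^+ size T.
Proof.
elim: T => [|s T IH] notz; first by rewrite big_nil mulr1 monE eqxx expr0.
rewrite big_cons mulrA mulrBr mulr1 mulrBl -mon_add.
have -> (f g : unitized R add) w : (f - g) w = f w - g w by rewrite !ffunE.
rewrite IH => [|m c sm]; last exact: (notz (false :: m) c (congr1 succn sm)).
rewrite coef_mon_prod_eq0 ?sub0r ?exprS ?mulN1r // => m sm eqz.
have [c cE] : exists c, sgsum add (s :: mask m T) = Some c.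
  by rewrite sgsum_cons; eexists.
apply: (notz (true :: m) c (congr1 succn sm) cE).
have : option_add add (sgsum add (s :: mask m T)) (Some z) = Some z.
  by rewrite sgsum_cons_option sgaddC sgaddA -{2}eqz.
by rewrite cE => -[].
Qed.

Lemma sum_idem_stabilized (T : seq S) (z : S) :
  sgsum add [seq e s | s <- T] = Some z ->
  \prod_(s <- T) (X s - X (e s)) = 0 ->
  (St add z :&: Sigma add T)%SET <> finset.set0.
Proof.
move=> zE prod0 St0.
(* [z] already contains the idempotent e(s) as a summand. *)
have absorb s : s \in T -> X z * X (e s) = X z.
  move=> sT; rewrite -zE mon_sgsum big_map (big_rem s) //=.
  by rewrite mulrAC -mon_add idem_idem.
have prodE : X z * \prod_(s <- T) (X s - X (e s)) = X z * \prod_(s <- T) (X s - 1).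
  elim: (T) absorb => [|s T' IH] absorb; first by rewrite !big_nil.
  rewrite !big_cons mulrCA IH => [|t tT]; last first.
    by apply: absorb; rewrite inE tT orbT.
  by rewrite !mulrA (mulrC _ (X z)) !mulrBr mulr1 absorb ?mem_head.
have := @coef_mon_prod z T; rewrite -prodE prod0 mulr0 ffunE => coef.
suff /esym/eqP : 0 = (-1) ^+ size T :> R by rewrite signr_eq0.
apply: coef => m c /eqP sm cE cz.
have /setP/(_ c) := St0; rewrite !inE cz eqxx => /existsP[].
by exists (Tuple sm); rewrite cE.
Qed.

Lemma sgprod_Xpow_sub_idem_eq0 (T : seq S) : (Lambda add <= size T)%N ->
  sgprod add [seq Xpow R s - Xpow R (e s) | s <- T] = Some 0.
Proof.
move=> le_T; have := extend0_sgprod add [seq Xpow R s - Xpow R (e s) | s <- T].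
rewrite big_map (eq_bigr (fun s => X s - X (e s))) => [|s _]; last first.
  by rewrite extend0B !extend0_Xpow.
(* [None] is excluded: its image is [1], not [0]. *)
rewrite prod_mon_sub_idem_eq0 //; case: sgprod => [f /extend0_eq0->//|].
by move=> /eqP; rewrite oner_eq0.
Qed.

End Vanishing.

Theorem theorem4p1 (p : nat) (S : finType) (add : SemiGroup.com_law S)
    (R : comNzRingType) (p_prime : prime p)
    (expS : exists r : nat, sgexp add = (p ^ r)%N)
    (charR : p \in [pchar R]) :
  (forall T : seq S, (Lambda add <= size T)%N ->
     sgprod add [seq Xpow R s - Xpow R (idem add s) | s <- T] = Some 0 /\
     exists2 e : S, sgsum add [seq idem add s | s <- T] = Some e &
       (St add e :&: Sigma add T)%SET <> finset.set0) /\
  (dconst R add <= ((Lambda add)%:Z - 1)%:E)%E.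
Proof.
split=> [T le_T|].
  split; first exact: sgprod_Xpow_sub_idem_eq0 expS charR _ le_T.
  have [z zE] : exists z, sgsum add [seq idem add s | s <- T] = Some z.
    by case: T le_T => [//|s T _]; rewrite /= sgsum_cons; eexists.
  exists z => //; apply: (@sum_idem_stabilized R _ _ _ _ zE).
  exact: prod_mon_sub_idem_eq0 expS charR _ le_T.
(* By leastness of the supremum, it suffices to bound each [l] in [dset]. *)
have [_] := natsupP (dset R add); apply=> _ [l [s sP] <-].
rewrite lee_fin lerBrDr -natz natr1 natz lez_nat ltnNge; apply/negP => le_l.
(* Taking every coefficient equal to [1] gives the product already shown to vanish. *)
apply: (sP (nseq_tuple l 1)) => [i|]; first by rewrite tnth_nseq oner_neq0.
rewrite -(sgprod_Xpow_sub_idem_eq0 expS charR (T := s)) ?size_tuple //.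
congr sgprod => /=; rewrite -[l in nseq l](size_tuple s).
by elim: (tval s) => //= x T ->; rewrite scale1r.
Qed.
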